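(* Let $G$ be a graph and let $k\in\mathbb{Z}$ with $k\ge 2$. Then $\nabla^k G$ is weakly critical.
   Context: All graphs are finite and simple; $|G|$ denotes the number of vertices of $G$. A coloring of a graph $G=(V,E)$ is a surjective map $\ell:V\to C$ onto a finite set $C$ of colors; it need not be proper. It is pseudocomplete if for any two distinct colors $i,j\in C$ there is an edge $uv\in E$ with $\{\ell(u),\ell(v)\}=\{i,j\}$. The pseudoachromatic number $\Psi(G)$ is the greatest number of colors used in a pseudocomplete coloring of $G$ (so $\Psi$ of the graph with no vertices is $0$). $\nabla^k G$ is the join of $k$ copies of $G$: the disjoint union of $k$ copies of $G$ together with all edges between vertices in different copies. For an integer $0\le j\le |G|$, $\operatorname{mpd}_G(j)=\min\{\Psi(G)-\Psi(G\setminus X) : X\subseteq V,\ |X|=j\}$, where $G\setminus X$ is the subgraph induced on $V\setminus X$. $G$ is weakly critical if $\operatorname{mpd}_G(j)\ge\lfloor j/2\rfloor$ for all $0\le j\le |G|$. *)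

(* Defs.v *)
From HB Require Import structures.
From mathcomp Require Import all_boot.

Set Implicit Arguments.
Unset Strict Implicit.
Unset Printing Implicit Defensive.

(* The empty graph is allowed. *)
Record sgraph := SGraph {
  svertex :> finType;
  sedge : rel svertex;
  sedge_sym : symmetric sedge;
  sedge_irr : irreflexive sedge
}.

Section Delete.
Variables (G : sgraph) (X : {set G}).

Definition del_vertex : finType := {x : G | x \notin X}.
Definition del_edge : rel del_vertex := fun u v => sedge (val u) (val v).

Lemma del_edge_sym : symmetric del_edge.
Proof. by move=> u v; apply: sedge_sym. Qed.

Lemma del_edge_irr : irreflexive del_edge.
Proof. by move=> u; apply: sedge_irr. Qed.

Definition delete : sgraph := SGraph del_edge_sym del_edge_irr.
End Delete.

Section IteratedJoin.
Variables (k : nat) (G : sgraph).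

Definition join_vertex : finType := ('I_k * G)%type.
Definition join_edge : rel join_vertex :=
  fun u v => (u.1 != v.1) || sedge u.2 v.2.

Lemma join_edge_sym : symmetric join_edge.
Proof. by move=> u v; rewrite /join_edge eq_sym sedge_sym. Qed.

Lemma join_edge_irr : irreflexive join_edge.
Proof. by move=> u; rewrite /join_edge eqxx sedge_irr. Qed.

Definition iter_join : sgraph := SGraph join_edge_sym join_edge_irr.
End IteratedJoin.

Definition coloring (G : sgraph) (C : finType) (l : {ffun G -> C}) : bool :=
  [forall c, exists v, l v == c].

Definition pseudocomplete (G : sgraph) (C : finType) (l : {ffun G -> C}) :
    bool :=
  [forall i : C, forall j : C, (i != j) ==>
    [exists u : G, exists v : G,
       sedge u v && ([set l u; l v] == [set i; j])]].

Definition has_pcc (G : sgraph) (n : nat) : bool :=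
  [exists l : {ffun G -> 'I_n}, coloring l && pseudocomplete l].

(* Surjectivity bounds the number of colors by #|G|, so this maximum ranges
   over all pseudocomplete colorings; see Psi_ge and Psi_attained. *)
Definition Psi (G : sgraph) : nat := \max_(n < #|G|.+1 | has_pcc G n) n.

(* The subtraction does not truncate (Psi_delete), and the default value Psi G
   is an upper bound of the terms, so for j <= #|G| this is the minimum over
   the j-subsets of vertices (mpdP). *)
Definition mpd (G : sgraph) (j : nat) : nat :=
  \big[minn/Psi G]_(X : {set G} | #|X| == j) (Psi G - Psi (delete X)).

Definition weakly_critical (G : sgraph) : Prop :=
  forall j : nat, j <= #|G| -> j./2 <= mpd G j.

Lemma coloring_card (G : sgraph) (C : finType) (l : {ffun G -> C}) :
  coloring l -> #|C| <= #|G|.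
Proof.
move=> /forallP sl.
have /subset_leq_card : C \subset codom l.
  by apply/subsetP => c _; have /existsP[v /eqP<-] := sl c; apply: codom_f.
by move=> h; apply: leq_trans h (leq_image_card _ _).
Qed.

Lemma Psi_ge (G : sgraph) (C : finType) (l : {ffun G -> C}) :
  coloring l -> pseudocomplete l -> #|C| <= Psi G.
Proof.
move=> sl pl; have le := coloring_card sl.
suff h : has_pcc G #|C|.
  exact: (bigmax_sup (Ordinal (le : #|C| < #|G|.+1))).
apply/existsP; exists [ffun v => enum_rank (l v)]; apply/andP; split.
  apply/forallP => c; have /existsP[v /eqP lv] := forallP sl (enum_val c).
  by apply/existsP; exists v; rewrite ffunE lv enum_valK.
apply/forallP => i; apply/forallP => j; apply/implyP => ij.
have nij : enum_val i != enum_val j by rewrite (inj_eq enum_val_inj).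
have /existsP[u /existsP[v /andP[uv /eqP E]]] :=
  implyP (forallP (forallP pl (enum_val i)) (enum_val j)) nij.
apply/existsP; exists u; apply/existsP; exists v; rewrite uv !ffunE /=.
have := congr1 (fun A : {set C} => [set enum_rank x | x in A]) E.
by rewrite !imsetU1 !imset_set1 !enum_valK => ->.
Qed.

Lemma Psi_attained (G : sgraph) : has_pcc G (Psi G).
Proof.
have [n hn] : exists n : 'I_#|G|.+1, has_pcc G n.
  have [G0|G0] := posnP #|G|.
    exists ord0; apply/existsP.
    have f (v : G) : 'I_0 by have := card0_eq G0 v; rewrite inE.
    exists [ffun v => f v]; apply/andP.
    by split; apply/forallP => -[].
  have h1 : 1 < #|G|.+1 by [].
  exists (Ordinal h1); apply/existsP; exists [ffun => ord0]; apply/andP; split.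
    have /card_gt0P[v _] := G0.
    by apply/forallP => c; apply/existsP; exists v; rewrite ffunE [c]ord1.
  by apply/forallP => i; apply/forallP => j; rewrite [i]ord1 [j]ord1.
rewrite /Psi; have [|m hm ->] := @eq_bigmax_cond _
  (fun n : 'I_#|G|.+1 => has_pcc G n) (fun n => n : nat).
  by apply/card_gt0P; exists n.
exact: hm.
Qed.

Lemma Psi_delete (G : sgraph) (X : {set G}) : Psi (delete X) <= Psi G.
Proof.
have [n0|n0] := posnP (Psi (delete X)); first by rewrite n0.
have /existsP[l /andP[/forallP sl /forallP pl]] := Psi_attained (delete X).
pose l' : {ffun G -> 'I_(Psi (delete X))} :=
  [ffun v => oapp l (Ordinal n0) (insub v)].
have l'E (v : delete X) : l' (val v) = l v.
  by rewrite ffunE (valK v : insub (val v) = Some v).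
rewrite -[X in X <= _]card_ord; apply: (@Psi_ge G _ l').
  apply/forallP => c; have /existsP[v lv] := sl c.
  by apply/existsP; exists (val v); rewrite l'E.
apply/forallP => i; apply/forallP => j; apply/implyP => ij.
have /existsP[u /existsP[v /andP[uv E]]] := implyP (forallP (pl i) j) ij.
apply/existsP; exists (val u); apply/existsP; exists (val v).
by rewrite !l'E E andbT.
Qed.

Lemma mpdP (G : sgraph) (j : nat) : j <= #|G| ->
  (exists2 X : {set G}, #|X| = j & mpd G j = Psi G - Psi (delete X)) /\
  (forall X : {set G}, #|X| = j -> mpd G j <= Psi G - Psi (delete X)).
Proof.
move=> jG.
have lb (X : {set G}) : #|X| = j -> mpd G j <= Psi G - Psi (delete X).
  move=> Xj; rewrite /mpd; have := mem_index_enum X.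
  elim: (index_enum _) => // Y s IHs; rewrite inE big_cons.
  case/predU1P => [<-|/IHs h]; first by rewrite Xj eqxx geq_minl.
  by case: ifP => // _; rewrite geq_min h orbT.
split=> //.
have [X0 X0j] : exists X0 : {set G}, #|X0| = j.
  exists [set x in take j (enum G)]; rewrite cardsE.
  by rewrite (card_uniqP (take_uniq _ (enum_uniq _))) size_takel -?cardE.
have [E|//] : mpd G j = Psi G \/
  exists2 X : {set G}, #|X| = j & mpd G j = Psi G - Psi (delete X).
  rewrite /mpd; elim/big_ind: _ => [|x y hx hy|X /eqP Xj]; first by left.
    by rewrite /minn; case: ifP.
  by right; exists X.
by exists X0 => //; apply/eqP; rewrite eqn_leq lb // E leq_subr.
Qed.

(* Main.v *)
Require Import Defs.
From mathcomp Require Import all_boot.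
From mathcomp Require Import zify.

(** Both [Psi (iter_join k G)] and [Psi] of each of its vertex-deleted subgraphs
    are controlled by the number [n] of vertices of [G] and its clique number
    [w].

    In a pseudocomplete coloring, two vertices whose color classes are
    singletons must be adjacent, so these vertices form a clique; every other
    class takes at least two vertices.  Hence a graph [H] has a clique [Q] with
    [2 * Psi H <= #|H| + #|Q|] ([double_Psi_le]).  A clique of the [k]-fold join,
    and so also of any induced subgraph of it, meets each copy of [G] in a clique
    and has at most [k * w] vertices ([clique_join_card]).  After deleting [j]
    vertices, [2 * Psi] is therefore at most [k * n - j + k * w].

    Conversely, let [K] be a clique of size [w] in [G] and give a color of its
    own to each of the [k * w] copies of its vertices.  The remaining
    [k * (n - w)] vertices can be grouped, up to a leftover one, into pairs lying
    in two different copies of [G], because [k >= 2].  Such a pair sees every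
    vertex of the join, since no vertex lies in both copies.  This gives
    [k * w + (k * (n - w))./2 <= Psi (iter_join k G)] ([Psi_join_ge]), which
    exceeds the previous bound by [j./2]. *)

Set Implicit Arguments.
Unset Strict Implicit.
Unset Printing Implicit Defensive.

Definition clique (G : sgraph) (Q : {set G}) : bool :=
  [forall u in Q, forall v in Q, (u != v) ==> sedge u v].

Lemma cliqueP (G : sgraph) (Q : {set G}) :
  reflect {in Q &, forall u v, u != v -> sedge u v} (clique Q).
Proof.
apply: (iffP forall_inP) => [h u v uQ vQ|h u uQ].
  by move/forall_inP: (h u uQ) => /(_ v vQ) /implyP.
by apply/forall_inP => v vQ; apply/implyP; apply: h.
Qed.

(** Each vertex is weighted 2 if its class is a singleton and 1 otherwise, so
    that every class has weight at least 2. *)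
Lemma double_Psi_le (G : sgraph) :
  exists2 Q : {set G}, clique Q & 2 * Psi G <= #|G| + #|Q|.
Proof.
have /existsP[l /andP[/forallP sl /forallP pl]] := Psi_attained G.
pose single c := #|[pred v | l v == c]| == 1.
exists [set v | single (l v)].
  apply/cliqueP => u v; rewrite !inE => su sv uv.
  have inj x y : single (l x) -> l y = l x -> y = x.
    move=> /card1P[z zE] yx; have := zE x; have := zE y.
    by rewrite !inE yx eqxx => /esym/eqP-> /esym/eqP->.
  have luv : l u != l v by apply: contraNneq uv => /inj->.
  have /existsP[x /existsP[y /andP[xy /eqP E]]] :=
    implyP (forallP (pl (l u)) (l v)) luv.
  have nxy : l x != l y.
    apply: contraNneq luv => exy; move: E; rewrite exy setUid => E.
    have := set21 (l u) (l v); have := set22 (l u) (l v).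
    by rewrite -E !inE => /eqP-> /eqP->.
  have := set21 (l x) (l y); have := set22 (l x) (l y).
  rewrite E !inE => /orP[]/eqP ly /orP[]/eqP lx;
    rewrite ?lx ?ly ?eqxx // in nxy *.
    by rewrite -(inj _ _ su ly) -(inj _ _ sv lx) sedge_sym.
  by rewrite -(inj _ _ su lx) -(inj _ _ sv ly).
have -> : #|G| + #|[set v | single (l v)]| = \sum_v (1 + single (l v)).
  by rewrite big_split /= sum1_card -sum1dep_card [in RHS]big_mkcond -big_mkcond.
rewrite (partition_big l predT) //= -[X in 2 * X]card_ord mulnC -sum_nat_const.
apply: leq_sum => c _.
rewrite (eq_bigr (fun=> 1 + single c)) => [|v /eqP-> //].
rewrite sum_nat_const.
have [v lv] := existsP (sl c).
have : 0 < #|[pred v | l v == c]| by apply/card_gt0P; exists v.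
have weight a : 0 < a -> 2 <= a * (1 + (a == 1)) by case: eqP => [->//|]; lia.
exact: weight.
Qed.

Lemma clique_delete (G : sgraph) (X : {set G}) (Q : {set delete X}) :
  clique Q -> clique [set (val u : G) | u in Q].
Proof.
move=> /cliqueP cQ; apply/cliqueP => _ _ /imsetP[u uQ ->] /imsetP[v vQ ->].
by rewrite (inj_eq val_inj) => /(cQ u v uQ vQ).
Qed.

Lemma card_delete (G : sgraph) (X : {set G}) : #|delete X| = #|G| - #|X|.
Proof. by rewrite card_sig -(cardC (mem X)) addKn. Qed.

Lemma clique_join_card (k w : nat) (G : sgraph) (Q : {set iter_join k G}) :
  (forall K : {set G}, clique K -> #|K| <= w) -> clique Q -> #|Q| <= k * w.
Proof.
move=> maxw /cliqueP cQ.
rewrite -sum1_card (partition_big (fun u : 'I_k * G => u.1) predT) //=.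
rewrite -[X in X * w]card_ord -sum_nat_const; apply: leq_sum => i _.
pose K := [set v | ((i, v) : iter_join k G) \in Q].
apply: leq_trans (maxw K _).
  have pair_inj : injective (pair i : G -> iter_join k G) by move=> u v [].
  rewrite sum1dep_card -(card_imset (mem K) pair_inj).
  apply: subset_leq_card; apply/subsetP => -[a v]; rewrite inE => /andP[avQ /eqP /= ai].
  by apply/imsetP; exists v; rewrite ?inE -?ai.
apply/cliqueP => u v; rewrite !inE => uK vK uv.
have := cQ _ _ uK vK; rewrite /= /join_edge xpair_eqE !eqxx /=.
exact.
Qed.

(** It is enough to color up to two vertices per color: the other vertices can
    be given any color, since this neither empties a class nor destroys an edge
    between two classes. *)
Lemma Psi_ge_repr (G : sgraph) (C : finType) (f : C -> bool -> G) :
  (forall c d b b', f c b = f d b' -> c = d) ->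
  (forall c d, c != d -> exists b b', sedge (f c b) (f d b')) ->
  #|C| <= Psi G.
Proof.
move=> inj adj; have [->//|/card_gt0P[c0 _]] := posnP #|C|.
pose l := [ffun v => odflt c0 [pick c | [exists b, f c b == v]]].
have lf c b : l (f c b) = c.
  rewrite ffunE; case: pickP => [d /existsP[b' /eqP/inj]//|/(_ c)/existsP[]].
  by exists b.
apply: (@Psi_ge G C l).
  by apply/forallP => c; apply/existsP; exists (f c true); rewrite lf.
apply/forallP => c; apply/forallP => d; apply/implyP => /adj[b [b' e]].
by apply/existsP; exists (f c b); apply/existsP; exists (f d b'); rewrite e !lf /=.
Qed.

(** The pairs come from listing the vertices outside the clique so that the copy
    index runs cyclically through ['I_k]: two consecutive vertices then lie in
    different copies. *)
Lemma Psi_join_ge (G : sgraph) (k : nat) (K : {set G}) :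
  2 <= k -> clique K ->
  k * #|K| + (k * (#|G| - #|K|))./2 <= Psi (iter_join k G).
Proof.
move=> k2 /cliqueP cK.
have k0 : 0 < k by lia.
have <- : #|~: K| = #|G| - #|K| by rewrite -(cardsC K) addKn.
set N := k * #|~: K|.
have divN t : t < N -> t %/ k < #|~: K| by rewrite ltn_divLR // mulnC.
pose copy t : 'I_k := Ordinal (ltn_pmod t k0).
pose vert t (tN : t < N) : iter_join k G :=
  (copy t, enum_val (Ordinal (divN t tN))).
have vert_inj t t' (tN : t < N) (tN' : t' < N) :
    vert t tN = vert t' tN' -> t = t'.
  case=> em /enum_val_inj[ed].
  by rewrite (divn_eq t k) (divn_eq t' k) em ed.
have idx (m : 'I_(N./2)) (b : bool) : m.*2 + b < N by case: m b => m /= mN []; lia.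
pose C : finType := (('I_k * {x : G | x \in K}) + 'I_(N./2))%type.
pose f (c : C) (b : bool) : iter_join k G := match c with
  | inl p => (p.1, val p.2)
  | inr m => vert _ (idx m b)
  end.
(* A pair meets two copies, so one of its vertices avoids the copy of [u]. *)
have pair_adj m (u : iter_join k G) : exists b, sedge (f (inr m) b) u.
  have ne : copy (m.*2 + false) != copy (m.*2 + true).
    apply/eqP => /(congr1 val) /= /eqP.
    by rewrite eqn_modDl !modn_small.
  case: (eqVneq (copy (m.*2 + false)) u.1) => [e|ne'].
    by exists true; rewrite /= /join_edge /= -e eq_sym ne.
  by exists false; rewrite /= /join_edge /= ne'.
have -> : k * #|K| + N./2 = #|C|.
  by rewrite card_sum card_prod !card_ord card_sig.
apply: (@Psi_ge_repr _ C f).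
  move=> [[i x]|m] [[i' x']|m'] b b' /=.
  - by case=> -> /val_inj->.
  - by case=> _ e; have := enum_valP (Ordinal (divN _ (idx m' b')));
      rewrite -e inE (valP x).
  - by case=> _ e; have := enum_valP (Ordinal (divN _ (idx m b)));
      rewrite e inE (valP x').
  - by move/vert_inj => e; congr inr; apply: val_inj => /=; case: b b' e => [] []; lia.
move=> [[i x]|m] d cd; last first.
  by have [b e] := pair_adj m (f d true); exists b, true.
case: d cd => [[i' x']|m'] cd; last first.
  by have [b e] := pair_adj m' (f (inl (i, x)) true); exists true, b; rewrite sedge_sym.
exists true, true; rewrite /= /join_edge /=.
case: (eqVneq i i') cd => //= -> cd; apply: cK; try exact: valP.
by apply: contraNneq cd => /val_inj->.
Qed.

Theorem theorem5p5 (G : sgraph) (k : nat) (hk : 2 <= k) :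
  weakly_critical (iter_join k G).
Proof.
move=> j jH; have [[X Xj ->] _] := mpdP jH.
have c0 : clique (set0 : {set G}) by apply/cliqueP => u v; rewrite inE.
have [K cK maxK] := @arg_maxnP _ set0 (@clique G) (fun Q => #|Q|) c0.
have [Q /clique_delete cQ upper] := double_Psi_le (delete X).
have := clique_join_card maxK cQ; rewrite (card_imset _ val_inj) => QK.
have {QK} := leq_trans upper (leq_add (leqnn _) QK).
have := Psi_join_ge hk cK.
have : k * #|K| <= k * #|G| by rewrite leq_mul2l max_card orbT.
move: jH; rewrite card_delete Xj mulnBr.
have -> : #|iter_join k G| = k * #|G| by rewrite card_prod card_ord.
lia.
Qed.
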